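(* Suppose that $\psi$ is $M$-smooth for some $M>0$, and fix $\gamma>0$. Set $\rho(\theta)=\frac{\|\theta\|_2^2}{2\gamma^2}$ and, for each $n\ge 1$, let $\widehat\theta_n=\arg\min_{\theta\in\mathbb{R}^d}\big\{\sum_{t=1}^n\ell_t(\theta)+\rho(\theta)\big\}$ and $\Lambda_n=\sum_{t=1}^nX_tX_t^{\top}$. Let $\delta\in(0,1)$ and define $$\beta_n=\frac{\|\widehat\theta_n\|_2^2}{2\gamma^2}+\frac12\log\det\big(\gamma^2M\Lambda_n+\mathrm{Id}\big)+\log\frac1\delta,\qquad \Theta_n=\Big\{\theta\in\mathbb{R}^d:\ \sum_{t=1}^n\big(\ell_t(\theta)-\ell_t(\widehat\theta_n)\big)\le\beta_n\Big\}.$$ Then $\mathbb{P}[\exists n\ge1:\ \theta^\star\notin\Theta_n]\le\delta$. In particular, if all the covariates are bounded as $\|X_t\|_2\le L$, then $$\beta_n\le\frac{\|\widehat\theta_n\|_2^2}{2\gamma^2}+\frac d2\log\Big(1+\frac{\gamma^2ML^2n}{d}\Big)+\log\frac1\delta .$$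
   Context: Generalized linear model (GLM). Fix $d\ge1$. Labels take values in a measurable set $\mathcal{Y}\subseteq\mathbb{R}$ equipped with a fixed $\sigma$-finite reference measure $\mathrm{d}y$ (e.g. Lebesgue or counting measure); all densities on $\mathcal{Y}$ are with respect to it. Let $h:\mathcal{Y}\to[0,\infty)$ and let $\psi:\mathbb{R}\to\mathbb{R}$ be convex and differentiable, such that for all $x,\theta\in\mathbb{R}^d$ the function $p(y|x,\theta)=\exp(\langle\theta,x\rangle y-\psi(\langle\theta,x\rangle))h(y)$ is a probability density on $\mathcal{Y}$. The data are random pairs $(X_t,Y_t)_{t\ge1}$ with $X_t\in\mathbb{R}^d$, $Y_t\in\mathcal{Y}$; let $\mathcal{F}_t=\sigma(X_1,Y_1,\dots,X_t,Y_t,X_{t+1})$ and $\mathcal{F}_0=\sigma(X_1)$. Covariates may be chosen adaptively: each $X_t$ may depend arbitrarily on $(X_k,Y_k)_{k<t}$. For a fixed unknown $\theta^\star\in\mathbb{R}^d$ and every $t\ge 1$, the conditional density of $Y_t$ given $\mathcal{F}_{t-1}$ is $p(\cdot|X_t,\theta^\star)$. Loss: $\ell_t(\theta)=-\langle\theta,X_t\rangle Y_t+\psi(\langle\theta,X_t\rangle)-\log h(Y_t)=-\log p(Y_t|X_t,\theta)$. $\psi$ is $M$-smooth if it is twice differentiable and $\psi''(z)\le M$ for all $z\in\mathbb{R}$. $\mathrm{Id}$ is the $d\times d$ identity matrix. *)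

(* Defs.v *)
From HB Require Import structures.
From mathcomp Require Import all_boot all_order all_algebra.
From mathcomp Require Import all_classical all_reals all_analysis.

Set Implicit Arguments.
Unset Strict Implicit.
Unset Printing Implicit Defensive.

Import Order.TTheory GRing.Theory Num.Theory.
Import numFieldNormedType.Exports.

Local Open Scope classical_set_scope.
Local Open Scope ring_scope.

Definition inner (R : realType) (d : nat) (u v : 'cV[R]_d) : R :=
  \sum_(i < d) u i ord0 * v i ord0.

(* The canonical norm `|u| on matrices is the sup norm, hence this definition. *)
Definition norm2 (R : realType) (d : nat) (u : 'cV[R]_d) : R :=
  Num.sqrt (inner u u).

Definition is_argmin (R : realType) (T : Type) (f : T -> R) (x : T) : Prop :=
  forall y, f x <= f y.

Definition smooth (R : realType) (M : R) (psi : R -> R) : Prop :=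
  forall z : R, [/\ derivable psi z 1, derivable (derive1 psi) z 1
                  & derive1 (derive1 psi) z <= M].

(* A measure [dy] on the label set [Yset] is represented by a measure [nu] on
   the Borel sets of [R], of which only the restriction to [Yset] is used. *)
Definition is_density (R : realType) (Yset : set R)
    (nu : {measure set R -> \bar R}) (f : R -> R) : Prop :=
  [/\ measurable_fun Yset f, (forall y, Yset y -> 0 <= f y)
    & (\int[nu]_(y in Yset) (f y)%:E = 1)%E].

Definition glm_density (R : realType) (d : nat) (h psi : R -> R)
    (x theta : 'cV[R]_d) (y : R) : R :=
  expR (inner theta x * y - psi (inner theta x)) * h y.

(* As [ln 0 = 0], this is [- log p(y | x, theta)] only when [0 < h y], which
   holds almost surely at [y = Y_t]. The term [ln (h y)] does not depend on
   [theta], so it plays no role in minimisers or in differences of losses. *)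
Definition glm_loss (R : realType) (d : nat) (h psi : R -> R)
    (x : 'cV[R]_d) (y : R) (theta : 'cV[R]_d) : R :=
  - (inner theta x * y) + psi (inner theta x) - ln (h y).

Section process.
Context (R : realType) (d : nat) (dO : measure_display)
  (Omega : measurableType dO).

(* Time starts at [1]: [X 0] and [Y 0] are never used. *)
Implicit Types (X : nat -> Omega -> 'cV[R]_d) (Y : nat -> Omega -> R).

(* The sigma-algebra generated by [X_1, Y_1, ..., X_n, Y_n, X_(n+1)], the Borel
   sigma-algebra of R^d being generated by the coordinates. *)
Definition history X Y (n : nat) : set (set Omega) :=
  <<s (\bigcup_(t in [set t | (1 <= t <= n.+1)%N]) \bigcup_(i in [set: 'I_d])
         preimage_set_system setT (fun w => X t w i ord0) measurable)
      `|`
      (\bigcup_(t in [set t | (1 <= t <= n)%N])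
         preimage_set_system setT (Y t) measurable) >>.

(* The [Yset]-valued variable [V] has conditional density [f w] given the
   sub-sigma-algebra [F], i.e. P(V \in B | F)(w) = \int_B f w y dy. *)
Definition cond_density (P : probability Omega R) (F : set (set Omega))
    (Yset : set R) (nu : {measure set R -> \bar R})
    (V : Omega -> R) (f : Omega -> R -> R) : Prop :=
  forall (A : set Omega) (B : set R), F A -> measurable B -> B `<=` Yset ->
    (P (A `&` V @^-1` B) = \int[P]_(w in A) \int[nu]_(y in B) (f w y)%:E)%E.

Definition cum_loss (h psi : R -> R) X Y (n : nat) (w : Omega)
    (theta : 'cV[R]_d) : R :=
  \sum_(1 <= t < n.+1) glm_loss h psi (X t w) (Y t w) theta.

Definition Lambda X (n : nat) (w : Omega) : 'M[R]_d :=
  \sum_(1 <= t < n.+1) X t w *m (X t w)^T.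

Definition rho (gamma : R) (theta : 'cV[R]_d) : R :=
  norm2 theta ^+ 2 / (2 * gamma ^+ 2).

Definition beta (gamma M delta : R) X (thetahat : nat -> Omega -> 'cV[R]_d)
    (n : nat) (w : Omega) : R :=
  norm2 (thetahat n w) ^+ 2 / (2 * gamma ^+ 2)
  + 2^-1 * ln (\det ((gamma ^+ 2 * M) *: Lambda X n w + 1%:M))
  + ln (delta^-1).

Definition Theta (h psi : R -> R) (gamma M delta : R) X Y
    (thetahat : nat -> Omega -> 'cV[R]_d) (n : nat) (w : Omega)
    : set 'cV[R]_d :=
  [set theta | \sum_(1 <= t < n.+1)
                 (glm_loss h psi (X t w) (Y t w) theta
                  - glm_loss h psi (X t w) (Y t w) (thetahat n w))
               <= beta gamma M delta X thetahat n w].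

End process.

(* Main.v *)
(** Method of mixtures. For a fixed [theta] the likelihood ratio
    [L_n(theta) = \prod_(t <= n) p(Y_t | X_t, theta) / p(Y_t | X_t, thetastar)]
    is a martingale, hence so is its average [W_n] over a centred Gaussian prior
    of variance [gamma ^ 2] on [theta], and Ville's inequality bounds by [delta]
    the probability that [W_n] ever reaches [1 / delta]. Since [log L_n(theta)]
    is a difference of cumulative losses, smoothness of [psi] together with the
    optimality of the penalised estimator bounds it from below by an explicit
    quadratic in [theta]; its Gaussian integral is the inverse square root of
    [\det (gamma ^ 2 M Lambda_n + Id)], so that [thetastar \notin Theta_n]
    forces [1 / delta <= W_n]. The bound on [beta_n] comes from
    [\det A <= (\tr A / d) ^ d]. *)
Require Import Defs.
From HB Require Import structures.
From mathcomp Require Import all_boot all_order all_algebra.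
From mathcomp Require Import all_classical all_reals all_analysis.
From mathcomp Require Import measurable_realfun ring lra.

Set Implicit Arguments.
Unset Strict Implicit.
Unset Printing Implicit Defensive.

Import Order.TTheory GRing.Theory Num.Theory.
Import numFieldNormedType.Exports.

Local Open Scope classical_set_scope.
Local Open Scope ring_scope.

(** * Positive definite matrices *)

Definition qform (R : realType) (n : nat) (A : 'M[R]_n) (u : 'cV[R]_n) : R :=
  (u^T *m A *m u) ord0 ord0.

Definition posdef (R : realType) (n : nat) (A : 'M[R]_n) : Prop :=
  A^T = A /\ forall u, u != 0 -> 0 < qform A u.

Section schur.
Context (R : realType) (n : nat) (A : 'M[R]_(1 + n)).
Hypothesis Apos : posdef A.

Local Notation a := (A ord0 ord0).
Local Notation b := (dlsubmx A).

(** The Schur complement of the corner entry. It drives both inductions on the dimension: the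
    determinant bound and the Gaussian integral. *)
Definition schur : 'M[R]_n := drsubmx A - a^-1 *: (b *m b^T).

Let AE : A = block_mx a%:M b^T b (drsubmx A).
Proof.
rewrite -[LHS]submxK; congr block_mx.
  by apply/matrixP => i j; rewrite !mxE !ord1 /= mulr1n; congr (A _ _);
    apply/val_inj.
by rewrite trmx_dlsub (proj1 Apos).
Qed.

Lemma posdef_corner : 0 < a.
Proof.
have := proj2 Apos (delta_mx ord0 ord0).
have -> : qform A (delta_mx ord0 ord0) = a.
  by rewrite /qform trmx_delta -rowE -colE !mxE.
apply; apply/eqP => /matrixP/(_ ord0 ord0); rewrite !mxE !eqxx /= => /eqP.
by rewrite oner_eq0.
Qed.

(* Completing the square in the first coordinate. *)
Lemma qform_schur (x : R) (u : 'cV[R]_n) :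
  qform A (col_mx x%:M u) =
  a * (x + a^-1 * (b^T *m u) ord0 ord0) ^+ 2 + qform schur u.
Proof.
have a0 := lt0r_neq0 posdef_corner.
set q := (b^T *m u) ord0 ord0.
have bu : b^T *m u = q%:M by rewrite [LHS]mx11_scalar.
have ub : u^T *m b = q%:M.
  by rewrite -[LHS]trmxK trmx_mul trmxK bu tr_scalar_mx.
rewrite /qform {1}AE tr_col_mx mul_row_block mul_row_col tr_scalar_mx.
rewrite /schur mulmxBr mulmxBl !mulmxDl -scalemxAr -scalemxAl.
rewrite mulmxA ub -!scalar_mxM -mulmxA bu -!scalar_mxM -[_ *m b^T *m u]mulmxA bu.
rewrite -!scalar_mxM !mxE eqxx !mulr1n.
by field.
Qed.

(** Choosing the first coordinate that cancels the square in [qform_schur] makes the form of [A], at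
    a nonzero vector, equal to that of [schur] at [u]. *)
Lemma posdef_schur : posdef schur.
Proof.
split.
  rewrite /schur linearB linearZ /= trmx_mul trmxK; congr (_ - _).
  by rewrite -[in RHS](proj1 Apos) trmx_drsub.
move=> u u0.
have := proj2 Apos (col_mx (- (a^-1 * (b^T *m u) ord0 ord0))%:M u).
rewrite qform_schur addNr expr0n /= mulr0 add0r; apply.
by apply: contra u0 => /eqP; rewrite -col_mx0 => /eq_col_mx[_ ->].
Qed.

(** One step of Gaussian elimination: multiplying on the right by the unipotent [U] clears the block
    [b^T] and leaves [schur] in the lower corner. *)
Lemma det_schur : \det A = a * \det schur.
Proof.
have a0 := lt0r_neq0 posdef_corner.
pose U : 'M[R]_(1 + n) := block_mx 1%:M (- a^-1 *: b^T) 0 1%:M.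
have detU : \det U = 1 by rewrite /U det_ublock !det1 mulr1.
rewrite -[LHS]mulr1 -detU -det_mulmx {1}AE /U mulmx_block !mulmx0 !mulmx1 !addr0.
have -> : a%:M *m (- a^-1 *: b^T) + b^T = 0.
  by rewrite mul_scalar_mx scalerA mulrN divff// scaleN1r addNr.
rewrite det_lblock det_scalar expr1; congr (_ * \det _).
by rewrite /schur -scalemxAr scaleNr addrC.
Qed.

Lemma trace_schur : \tr schur <= \tr A - a.
Proof.
have -> : \tr A = a + \tr (drsubmx A).
  by rewrite {1}AE mxtrace_block mxtrace_scalar mulr1n.
rewrite addrAC subrr add0r /schur linearB/= lerBlDr lerDl mxtraceZ.
apply: mulr_ge0; first by rewrite invr_ge0 ltW// posdef_corner.
rewrite /mxtrace; apply: sumr_ge0 => i _; rewrite mxE big_ord1 !mxE -expr2.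
exact: sqr_ge0.
Qed.

End schur.

Lemma posdef_det_gt0 (R : realType) (n : nat) (A : 'M[R]_n) :
  posdef A -> 0 < \det A.
Proof.
elim: n A => [|n IHn] A Apos; first by rewrite det_mx00.
rewrite (det_schur Apos) mulr_gt0 ?(posdef_corner Apos)// IHn//.
exact: posdef_schur.
Qed.

(** The pivots multiply to the determinant, each satisfies [x <= expR (x - 1)], and by [trace_schur]
    they add up to at most the trace. This replaces a diagonalisation. *)
Lemma posdef_det_le_expR (R : realType) (n : nat) (A : 'M[R]_n) :
  posdef A -> \det A <= expR (\tr A - n%:R).
Proof.
elim: n A => [|n IHn] A Apos.
  by rewrite det_mx00 /mxtrace big_ord0 subr0 expR0.
rewrite (det_schur Apos).
have a0 := posdef_corner Apos.
have -> : \tr A - n.+1%:R = (A ord0 ord0 - 1) + (\tr A - A ord0 ord0 - n%:R).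
  by rewrite -natr1; ring.
rewrite expRD ler_pM ?(ltW a0)//.
- exact/ltW/posdef_det_gt0/posdef_schur.
- by have := expR_ge1Dx (A ord0 ord0 - 1); rewrite addrC subrK.
- apply: le_trans (IHn _ (posdef_schur Apos)) _.
  by rewrite ler_expR lerD2r; exact: trace_schur.
Qed.

Lemma qformZ (R : realType) (n : nat) (c : R) (A : 'M[R]_n) u :
  qform (c *: A) u = c * qform A u.
Proof. by rewrite /qform -scalemxAr -scalemxAl mxE. Qed.

Lemma posdef_trace_gt0 (R : realType) (n : nat) (A : 'M[R]_n) :
  (0 < n)%N -> posdef A -> 0 < \tr A.
Proof.
move=> n0 Apos.
have Aii i : 0 < A i i.
  have := proj2 Apos (delta_mx i ord0).
  have -> : qform A (delta_mx i ord0) = A i i.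
    by rewrite /qform trmx_delta -rowE -colE !mxE.
  apply; apply/eqP => /matrixP/(_ i ord0); rewrite !mxE !eqxx /= => /eqP.
  by rewrite oner_eq0.
rewrite /mxtrace (bigD1 (Ordinal n0))//= ltr_pwDl//.
by apply: sumr_ge0 => i _; exact: ltW.
Qed.

(** Dividing [A] by the mean of its diagonal makes the exponent in [posdef_det_le_expR] vanish. *)
Lemma posdef_det_le_trace (R : realType) (n : nat) (A : 'M[R]_n) :
  (0 < n)%N -> posdef A -> \det A <= (\tr A / n%:R) ^+ n.
Proof.
move=> n0 Apos.
have nR : 0 < n%:R :> R by rewrite ltr0n.
have tr0 := posdef_trace_gt0 n0 Apos.
have l0 : 0 < \tr A / n%:R by rewrite divr_gt0.
have Bpos : posdef ((\tr A / n%:R)^-1 *: A).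
  split; first by rewrite linearZ /= (proj1 Apos).
  by move=> u u0; rewrite qformZ mulr_gt0 ?invr_gt0// (proj2 Apos).
have := posdef_det_le_expR Bpos.
rewrite detZ mxtraceZ invf_div divfK ?lt0r_neq0// subrr expR0.
by rewrite -invf_div exprVn mulrC ler_pdivrMr ?exprn_gt0// mul1r.
Qed.

(** * Densities and joint laws *)

Section density.
Local Open Scope ereal_scope.
Context d (T : measurableType d) (R : realType).
Variables (mu nu : {measure set T -> \bar R}) (p : T -> R).
Hypotheses (mp : measurable_fun setT p) (p0 : forall x, (0 <= p x)%R).
Hypothesis nuE : forall A, measurable A -> nu A = \int[mu]_(x in A) (p x)%:E.

Import HBNNSimple.

(** The hypothesis [nuE] settles indicators; linearity extends it to simple functions, and monotone
    convergence along [nnsfun_approx] to [f]. *)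
Lemma ge0_integral_density (f : T -> \bar R) :
  measurable_fun setT f -> (forall x, 0 <= f x) ->
  \int[nu]_x f x = \int[mu]_x (f x * (p x)%:E).
Proof.
move=> mf f0; pose g := nnsfun_approx measurableT mf.
have mpE : measurable_fun setT (fun x => (p x)%:E) by exact/measurable_EFinP.
have cvgf x : (g n x)%:E @[n --> \oo] --> f x by exact: cvg_nnsfun_approx.
have mg n : measurable_fun setT (fun x => (g n x)%:E) by exact/measurable_EFinP.
transitivity (limn (fun n => \int[nu]_x (g n x)%:E)).
  rewrite -monotone_convergence//.
  - by apply: eq_integral => x _; apply/esym/cvg_lim.
  - by move=> n x _; rewrite lee_fin.
  - by move=> x _ a b ab; rewrite lee_fin; exact/lefP/nd_nnsfun_approx.
transitivity (limn (fun n => \int[mu]_x ((g n x)%:E * (p x)%:E))); last first.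
  rewrite -monotone_convergence//.
  - apply: eq_integral => x _; apply/cvg_lim => //.
    exact: cvgeZr.
  - by move=> n; exact: emeasurable_funM.
  - by move=> n x _; rewrite mule_ge0// lee_fin.
  - move=> x _ a b ab; apply: lee_wpmul2r; rewrite ?lee_fin//.
    exact/lefP/nd_nnsfun_approx.
congr (limn _); apply/funext => n.
have mk k : measurable_fun setT (fun x => (k * \1_(g n @^-1` [set k]) x)%:E).
  exact/measurable_EFinP/measurable_funM.
under eq_integral do rewrite fimfunE -fsumEFin//.
under [RHS]eq_integral => x _.
  rewrite fimfunE -fsumEFin// ge0_mule_fsuml; last first.
    by move=> k; rewrite nnfun_muleindic_ge0.
  over.
rewrite !ge0_integral_fsum//; last 3 first.
- by move=> k; exact: emeasurable_funM.
- by move=> k x _; rewrite mule_ge0 ?nnfun_muleindic_ge0 ?lee_fin.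
- by move=> k x _; rewrite nnfun_muleindic_ge0.
apply: eq_fsbigr => k; rewrite inE => -[y _ <-{k}].
rewrite integralZl_indic_nnsfun// integral_indic// setIT nuE//.
under [RHS]eq_integral do rewrite EFinM -muleA.
rewrite ge0_integralZl ?lee_fin//; last 2 first.
- by apply: emeasurable_funM => //; exact/measurable_EFinP.
- by move=> x _; rewrite mule_ge0 ?lee_fin.
congr (_ * _); rewrite integral_mkcond; apply: eq_integral => x _.
by rewrite patchE indicE; case: ifP => _; rewrite ?mul1e ?mul0e.
Qed.

End density.

Section joint_density.
Local Open Scope ereal_scope.
Context d (T : measurableType d) (R : realType) (P : probability T R).
Context d1 (S : measurableType d1) d2 (U : measurableType d2).
Variables (Z : T -> S) (V : T -> U).
Hypotheses (mZ : measurable_fun setT Z) (mV : measurable_fun setT V).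
Variable kap : {sigma_finite_measure set U -> \bar R}.
Variable f : S * U -> R.
Hypotheses (mf : measurable_fun setT f) (f0 : forall z, (0 <= f z)%R).
Hypothesis PE : forall A B, measurable A -> measurable B ->
  P (Z @^-1` A `&` V @^-1` B) =
  \int[P]_(w in Z @^-1` A) \int[kap]_(y in B) (f (Z w, y))%:E.

Let mfE : measurable_fun setT (fun z => (f z)%:E).
Proof. exact/measurable_EFinP. Qed.

Let PZ : probability S R := distribution P (mfun_Sub (mem_set mZ)).

Let ZV w := (Z w, V w).
Let mZV : measurable_fun setT ZV.
Proof. exact: measurable_fun_pair. Qed.

Let PZV : probability (S * U)%type R := distribution P (mfun_Sub (mem_set mZV)).

Let D : {measure set (S * U)%type -> \bar R} := (PZ \x kap).

(** The candidate for the joint law of [Z] and [V], built as a measure so that it can be compared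
    with [PZV] on rectangles. *)
Let m2 (C : set (S * U)) := \int[D]_(z in C) (f z)%:E.

Let m2_0 : m2 set0 = 0. Proof. exact: integral_set0. Qed.
Let m2_ge0 C : 0 <= m2 C.
Proof. by apply: integral_ge0 => z _; rewrite lee_fin. Qed.
Let m2_sadd : semi_sigma_additive m2.
Proof. by apply: semi_sigma_additive_nng_induced => // z; rewrite lee_fin. Qed.

HB.instance Definition _ := isMeasure.Build _ _ _ m2 m2_0 m2_ge0 m2_sadd.

Let m2X (A : set S) (B : set U) : measurable A -> measurable B ->
  m2 (A `*` B) = PZV (A `*` B).
Proof.
move=> mA mB; pose h z := \int[kap]_(y in B) (f (z, y))%:E.
have h0 z : 0 <= h z by apply: integral_ge0 => y _; rewrite lee_fin.
have mh : measurable_fun setT h.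
  pose fB := (fun z => (f z)%:E) \_ (setT `*` B).
  rewrite (_ : h = fubini_F kap fB); last first.
    apply/funext => z; rewrite /h integral_mkcond; apply: eq_integral => y _.
    by rewrite /fB !patchE in_setX in_setT.
  apply: measurable_fun_fubini_tonelli_F.
    apply: (measurable_restrictT _ _).1; first exact: measurableX.
    exact: measurable_funTS.
  by move=> z; apply: erestrict_ge0 => ? _; rewrite lee_fin.
rewrite /m2 integral_mkcond fubini_tonelli1//=; last 2 first.
- apply: (measurable_restrictT _ _).1; first exact: measurableX.
  exact: measurable_funTS.
- by move=> z; apply: erestrict_ge0 => ? _; rewrite lee_fin.
transitivity (\int[PZ]_(z in A) h z).
  rewrite [RHS]integral_mkcond; apply: eq_integral => z _.
  rewrite /fubini_F patchE; case: ifPn => zA.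
    rewrite /h [RHS]integral_mkcond; apply: eq_integral => y _.
    by rewrite !patchE in_setX zA.
  by apply: integral0_eq => y _; rewrite patchE in_setX (negbTE zA).
rewrite ge0_integral_pushforward//; last exact: measurable_funTS.
by rewrite /PZV /distribution /pushforward/= -PE.
Qed.

(** Measurable rectangles are stable under intersection and generate the product sigma-algebra, so
    for finite measures the agreement [m2X] suffices. *)
Let m2E C : measurable C -> PZV C = m2 C.
Proof.
move=> mC; apply/esym.
pose G := [set A `*` B | A in @measurable _ S & B in @measurable _ U].
apply: (measure_unique G (fun=> setT)) => //.
- by rewrite measurable_prod_measurableType.
- move=> _ _ [A1 mA1 [B1 mB1 <-]] [A2 mA2 [B2 mB2 <-]].
  rewrite -setXI; exists (A1 `&` A2); first exact: measurableI.
  by exists (B1 `&` B2) => //; exact: measurableI.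
- by move=> _; exists setT => //; exists setT => //; rewrite setXTT.
- by rewrite bigcup_const//; exists 0%N.
- by move=> _ [A mA [B mB <-]]; exact: m2X.
- move=> _; have := m2X measurableT measurableT; rewrite setXTT /= => ->.
  by rewrite (le_lt_trans (probability_le1 _ _)) ?ltry.
Qed.

Lemma integral_joint_density (g : S * U -> \bar R) :
  measurable_fun setT g -> (forall z, 0 <= g z) ->
  \int[P]_w g (Z w, V w) =
  \int[P]_w \int[kap]_y (g (Z w, y) * (f (Z w, y))%:E).
Proof.
move=> mg g0.
have mgf : measurable_fun setT (fun z => g z * (f z)%:E).
  exact: emeasurable_funM.
have gf0 z : 0 <= g z * (f z)%:E by rewrite mule_ge0 ?lee_fin.
transitivity (\int[PZV]_z g z); first by rewrite ge0_integral_pushforward.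
rewrite (@ge0_integral_density _ _ _ D PZV f)// fubini_tonelli1//.
rewrite ge0_integral_pushforward//; first exact: measurable_fun_fubini_tonelli_F.
by move=> z _; apply: integral_ge0.
Qed.

End joint_density.

(** Each covering set is enlarged by the complement of [D], which is null for the restricted
    measure. *)
Lemma sigma_finite_mrestr d (T : measurableType d) (R : realType)
    (mu : {measure set T -> \bar R}) (D : set T) (mD : measurable D) :
  sigma_finite D mu -> sigma_finite setT (mrestr mu mD).
Proof.
move=> [F DF mF]; exists (fun n => F n `|` ~` D).
  rewrite bigcupUl; last by exists 0%N.
  by rewrite -DF setUv.
move=> i; split; first by apply: measurableU; [exact: (mF i).1|exact: measurableC].
rewrite /mrestr setIUl setICl setU0 (le_lt_trans _ (mF i).2)// le_measure ?inE//.
  by apply: measurableI => //; exact: (mF i).1.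
exact: (mF i).1.
Qed.

Lemma ge0_integral_mrestr d (T : measurableType d) (R : realType)
    (mu : {measure set T -> \bar R}) (D : set T) (mD : measurable D)
    (B : set T) (f : T -> \bar R) :
  measurable B -> measurable_fun setT f -> (forall x, 0 <= f x)%E ->
  (\int[mrestr mu mD]_(x in B) f x = \int[mu]_(x in B `&` D) f x)%E.
Proof.
move=> mB mf f0.
rewrite [LHS]integral_mkcond (@ge0_integral_density _ _ _ mu (mrestr mu mD) (\1_D))//.
- rewrite [RHS]integral_mkcond; apply: eq_integral => x _.
  rewrite !patchE in_setI indicE; case: (x \in B); case: (x \in D);
    by rewrite /= ?mule1 ?mule0.
- by move=> A mA; rewrite integral_indic// setIC.
- by apply: (measurable_restrictT _ _).1 => //; exact: measurable_funTS.
- by move=> x; apply: erestrict_ge0 => ? _.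
Qed.

Section cond_density_theory.
Local Open Scope ereal_scope.
Context (R : realType) d (Omega : measurableType d) (P : probability Omega R).
Variables (G : set (set Omega)) (Gm : G `<=` measurable).
Variables (Yset : set R) (mYset : measurable Yset).
Variables (nu : {measure set R -> \bar R}) (sfnu : sigma_finite Yset nu).
Variables (V : Omega -> R) (mV : measurable_fun setT V).
Hypothesis VY : forall w, Yset (V w).
Variable f : g_sigma_algebraType G * R -> R.
Hypotheses (mf : measurable_fun setT f) (f0 : forall z, (0 <= f z)%R).
Hypothesis Vf : cond_density P <<s G >> Yset nu V (fun w y => f (w, y)).

Let mid : measurable_fun setT (id : Omega -> g_sigma_algebraType G).
Proof.
move=> _ A mA; rewrite setTI preimage_id.
exact: (smallest_sub (@sigma_algebra_measurable _ Omega) Gm).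
Qed.

(** Here [Z] in [integral_joint_density] is the identity, viewed as a map into [Omega] with the
    sigma-algebra generated by [G]. *)
Lemma integral_cond_density (g : g_sigma_algebraType G * R -> \bar R) :
  measurable_fun setT g -> (forall z, 0 <= g z) ->
  \int[P]_w g (w, V w) =
  \int[P]_w \int[nu]_(y in Yset) (g (w, y) * (f (w, y))%:E).
Proof.
move=> mg g0.
have mgf : measurable_fun setT (fun z => g z * (f z)%:E).
  by apply: emeasurable_funM => //; exact/measurable_EFinP.
(* Tonelli asks for sigma-finiteness on the whole line, which the restriction of [nu] to [Yset]
   has. *)
pose sf : Measure_isSigmaFinite _ _ _ (mrestr nu mYset) :=
  Measure_isSigmaFinite.Build _ _ _ _ (sigma_finite_mrestr mYset sfnu).
pose kap : {sigma_finite_measure set R -> \bar R} :=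
  HB.pack (mrestr nu mYset) sf.
have kapE (h : R -> \bar R) (B : set R) : measurable B -> measurable_fun setT h ->
    (forall y, 0 <= h y) ->
    \int[kap]_(y in B) h y = \int[nu]_(y in B `&` Yset) h y.
  by move=> mB mh h0; exact: ge0_integral_mrestr.
rewrite (@integral_joint_density _ _ _ P _ (g_sigma_algebraType G) _ _
  id V mid mV kap f)//.
  apply: eq_integral => w _; rewrite kapE ?setTI//.
    exact: (measurable_fun_pair2 (w : g_sigma_algebraType G) mgf).
  by move=> y; rewrite mule_ge0 ?lee_fin.
move=> A B mA mB; rewrite preimage_id.
(* The conditional density speaks of subsets of [Yset], and [V] never leaves [Yset]. *)
have -> : V @^-1` B = V @^-1` (B `&` Yset).
  by apply/seteqP; split => w /= => [Bw|[]//]; split.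
rewrite (Vf mA (measurableI _ _ mB mYset) (@subIsetr _ _ _)).
apply: eq_integral => w _; rewrite kapE//; last by move=> y; rewrite lee_fin.
apply/measurable_EFinP; exact: (measurable_fun_pair2 (w : g_sigma_algebraType G) mf).
Qed.

End cond_density_theory.

(** * Gaussian integrals *)

Lemma integral_gauss1 (R : realType) (a m : R) : 0 < a ->
  (\int[lebesgue_measure]_(x in setT) (expR (- 2^-1 * (a * (x - m) ^+ 2)))%:E =
   (Num.sqrt (2 * pi) / Num.sqrt a)%:E)%E.
Proof.
move=> a0; pose s := (Num.sqrt a)^-1.
have sa0 : 0 < Num.sqrt a by rewrite sqrtr_gt0.
have s0 : s != 0 by rewrite invr_eq0 gt_eqF.
have s2 : s ^+ 2 = a^-1 by rewrite exprVn sqr_sqrtr ?ltW.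
have := integral_normal_pdf m s; rewrite (normal_pdfE _ s0).
under eq_integral do rewrite EFinM.
rewrite ge0_integralZl//; last 3 first.
- by apply/measurable_EFinP; exact: measurable_normal_fun.
- by move=> x _; rewrite lee_fin normal_fun_ge0.
- by rewrite lee_fin normal_peak_ge0.
have p0 := normal_peak_gt0 s0.
have -> : (Num.sqrt (2 * pi) / Num.sqrt a) = (normal_peak s)^-1.
  rewrite /normal_peak invrK s2 -sqrtrV ?ltW// -sqrtrM; last first.
    by rewrite mulr_ge0// ?pi_ge0.
  by congr Num.sqrt; rewrite -mulr_natl; ring.
move=> /(congr1 (fun z => (normal_peak s)^-1%:E * z)%E).
rewrite muleA -EFinM mulVf ?gt_eqF// mul1e mule1 => <-.
apply: eq_integral => x _; rewrite /normal_fun s2; congr ((expR _)%:E).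
by field; rewrite gt_eqF.
Qed.

(** The term [x ^+ 2] cancels the exponent of the standard normal density, leaving a Gaussian
    integral against Lebesgue measure. *)
Lemma integral_normal_prob01_gauss (R : realType) (a m : R) : 0 < a ->
  (\int[normal_prob 0 1]_(x in setT)
     (expR (2^-1 * (x ^+ 2 - a * (x - m) ^+ 2)))%:E =
   ((Num.sqrt a)^-1)%:E)%E.
Proof.
move=> a0.
have mg (b c : R) : measurable_fun setT (fun x : R => b * (x - c) ^+ 2).
  by apply: measurable_funM => //; apply: measurable_funX; apply: measurable_funB.
rewrite (@ge0_integral_density _ _ _ lebesgue_measure _ (normal_pdf 0 1))//.
- have p0 : 0 < Num.sqrt (2 * pi) :> R by rewrite sqrtr_gt0 mulr_gt0// pi_gt0.
  transitivity (\int[lebesgue_measure]_(x in [set: R]) ((Num.sqrt (2 * pi))^-1%:E *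
      (expR (- 2^-1 * (a * (x - m) ^+ 2)))%:E))%E.
    apply: eq_integral => x _; rewrite -!EFinM; congr (_%:E).
    rewrite normal_pdfE ?oner_eq0// /normal_peak /normal_fun expr1n mul1r subr0.
    rewrite -[pi *+ 2]mulr_natl mulrCA -expRD; congr (_ * expR _).
    by move: (x : R) => y; field.
  rewrite ge0_integralZl//=.
  + rewrite integral_gauss1// -EFinM; congr (_%:E).
    by rewrite mulrA mulVf ?gt_eqF// mul1r.
  + apply/measurable_EFinP; apply: measurableT_comp => //.
    by apply: measurable_funM => //; exact: mg.
- exact: measurable_normal_pdf.
- by move=> x; exact: normal_pdf_ge0.
- apply/measurable_EFinP; apply: measurableT_comp => //.
  by apply: measurable_funM => //; apply: measurable_funB => //; exact: mg.
Qed.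

Lemma measurable_qform (R : realType) (n : nat) d (T : measurableType d)
    (v : T -> 'cV[R]_n) (A : 'M[R]_n) (c : 'cV[R]_n) :
  (forall i, measurable_fun setT (fun s => v s i ord0)) ->
  measurable_fun setT (fun s => qform A (v s - c)).
Proof.
move=> mv.
rewrite (_ : (fun _ => _) = fun s => \sum_j (\sum_k
    (v s k ord0 - c k ord0) * A k j) * (v s j ord0 - c j ord0)); last first.
  apply/funext => s; rewrite /qform mxE; apply: eq_bigr => j _.
  congr (_ * _); last by rewrite !mxE.
  by rewrite mxE; apply: eq_bigr => k _; rewrite !mxE.
apply: measurable_sum => j; apply: measurable_funM; last exact: measurable_funB.
apply: measurable_sum => k; apply: measurable_funM => //.
exact: measurable_funB.
Qed.

Lemma measurable_inner (R : realType) (n : nat) d (T : measurableType d)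
    (u v : T -> 'cV[R]_n) :
  (forall i, measurable_fun setT (fun s => u s i ord0)) ->
  (forall i, measurable_fun setT (fun s => v s i ord0)) ->
  measurable_fun setT (fun s => inner (u s) (v s)).
Proof. by move=> mu mv; apply: measurable_sum => i; exact: measurable_funM. Qed.

(* [v] is a standard Gaussian vector, on some probability space. *)
Lemma gaussian_integral (R : realType) (n : nat) :
  exists (d : measure_display) (T : measurableType d)
    (mu : probability T R) (v : T -> 'cV[R]_n),
  (forall i, measurable_fun setT (fun s => v s i ord0)) /\
  forall (A : 'M[R]_n) (c : 'cV[R]_n), posdef A ->
    (\int[mu]_(s in setT)
        (expR (2^-1 * (inner (v s) (v s) - qform A (v s - c))))%:E =
     ((Num.sqrt (\det A))^-1)%:E)%E.
Proof.
elim: n => [|n [d [T [mu [v [mv muE]]]]]].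
  exists _, _, (dirac tt : probability unit R), (fun=> 0).
  split=> [[]//|A c _].
  rewrite integral_dirac// diracT mul1e det_mx00 sqrtr1 invr1.
  by rewrite /inner /qform [X in _ *m X]flatmx0 mulmx0 mxE big_ord0 subr0 mulr0 expR0.
(* One more independent standard normal coordinate is put in front of [v]. *)
exists _, _, (mu \x (normal_prob 0 1 : probability (measurableTypeR R) R))%E.
exists (fun s => col_mx s.2%:M (v s.1) : 'cV[R]_(1 + n)).
have mv' (i : 'I_(1 + n)) : measurable_fun setT
    (fun s : T * measurableTypeR R =>
       (col_mx s.2%:M (v s.1) : 'cV[R]_(1 + n)) i ord0).
  case: (split_ordP i) => j ->.
    under eq_fun do rewrite col_mxEu mxE ord1 eqxx mulr1n.
    exact: measurable_snd.
  under eq_fun do rewrite col_mxEd.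
  exact: (measurableT_comp (mv j) measurable_fst).
split=> [//|]; rewrite -[n.+1]/(1 + n)%N => A c Apos.
have a0 := posdef_corner Apos; have Spos := posdef_schur Apos.
set a := A ord0 ord0 in a0 *.
pose c1 := usubmx c : 'M[R]_1; pose c2 := dsubmx c : 'cV[R]_n.
(* Given the other coordinates, the form is least when the first one equals [m s], the centre of the
   square completed by [qform_schur]. *)
pose m (s : T) := c1 ord0 ord0 - a^-1 * ((dlsubmx A)^T *m (v s - c2)) ord0 ord0.
have E (s : T) (x : R) :
    2^-1 * (inner (col_mx x%:M (v s) : 'cV[R]_(1 + n)) (col_mx x%:M (v s))
      - qform A (col_mx x%:M (v s) - c)) =
    2^-1 * (inner (v s) (v s) - qform (schur A) (v s - c2)) +
    2^-1 * (x ^+ 2 - a * (x - m s) ^+ 2).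
  rewrite -[c in LHS]vsubmxK opp_col_mx add_col_mx -/c1 -/c2.
  have -> : x%:M - c1 = (x - c1 ord0 ord0)%:M.
    by rewrite {1}[c1]mx11_scalar raddfB.
  rewrite qform_schur// -mulrDr /m opprB.
  rewrite [in LHS]/inner big_split_ord/= big_ord1 !col_mxEu !mxE eqxx mulr1n.
  under eq_bigr do rewrite !col_mxEd.
  by rewrite -/(inner _ _) -/a; ring.
have mf : measurable_fun setT (fun s : T * measurableTypeR R =>
    (expR (2^-1 *
      (inner (col_mx s.2%:M (v s.1) : 'cV[R]_(1 + n)) (col_mx s.2%:M (v s.1))
      - qform A (col_mx s.2%:M (v s.1) - c))))%:E).
  apply/measurable_EFinP; apply: measurableT_comp => //.
  apply: measurable_funM => //; apply: measurable_funB.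
    exact: (measurable_inner mv' mv').
  exact: (measurable_qform A c mv').
(* Integrating the new coordinate first yields the pivot factor [(Num.sqrt a)^-1]; the induction
   hypothesis for [schur A] gives the rest, and [det_schur] combines the two. *)
rewrite fubini_tonelli1//=.
rewrite /fubini_F /=.
transitivity (\int[mu]_s
   ((expR (2^-1 * (inner (v s) (v s) - qform (schur A) (v s - c2))))%:E *
    ((Num.sqrt a)^-1)%:E))%E.
  apply: eq_integral => s _.
  rewrite -(integral_normal_prob01_gauss (m s) a0) -ge0_integralZl//=.
  - by apply: eq_integral => x _; rewrite E expRD EFinM.
  - apply/measurable_EFinP; apply: measurableT_comp => //.
    apply: measurable_funM => //; apply: measurable_funB => //.
    apply: measurable_funM => //.
    by apply: measurable_funX; apply: measurable_funB.
rewrite ge0_integralZr//=; last first.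
- apply/measurable_EFinP; apply: measurableT_comp => //.
  apply: measurable_funM => //; apply: measurable_funB.
    exact: measurable_inner.
  exact: measurable_qform.
by rewrite muE// -EFinM (det_schur Apos) sqrtrM ?ltW// invfM mulrC.
Qed.

(** * Penalised maximum likelihood *)

(** A form of the mean value theorem that covers increments [w] of either sign at once. *)
Lemma MVT_affine (R : realType) (f df : R -> R) (x w : R) :
  (forall y : R, is_derive y (1 : R) f (df y)) ->
  exists2 t, 0 <= t <= 1 & f (x + w) - f x = df (x + t * w) * w.
Proof.
move=> fd.
have cf (a b : R) : {within `[a, b], continuous f}.
  by apply: derivable_within_continuous => y _; have [] := fd y.
have [w0|w0|->] := ltgtP w 0; last first.
- by exists 0; rewrite ?lexx ?ler01// mulr0 addr0 subrr.
- have xw : x <= x + w by rewrite lerDl ltW.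
  have [c] := MVT_segment xw (fun y _ => fd y) (cf _ _).
  rewrite in_itv/= => /andP[xc cw]; rewrite addrAC subrr add0r => E.
  exists ((c - x) / w); last by rewrite divfK ?gt_eqF// subrKC.
  by rewrite divr_ge0 ?subr_ge0 ?(ltW w0)//= ler_pdivrMr// mul1r lerBlDl.
- have xw : x + w <= x by rewrite gerDl ltW.
  have [c] := MVT_segment xw (fun y _ => fd y) (cf _ _).
  rewrite in_itv/= => /andP[xc cw] E.
  exists ((c - x) / w); last by rewrite divfK ?lt_eqF// subrKC -opprB E; ring.
  rewrite ler_ndivrMr// mul1r lerBrDl xc andbT.
  by rewrite nmulr_lge0 ?invr_lt0// subr_le0.
Qed.

Lemma smooth_quadratic_bound (R : realType) (M : R) (psi : R -> R) (z w : R) :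
  smooth M psi ->
  psi (z + w) <= psi z + derive1 psi z * w + M / 2 * w ^+ 2.
Proof.
move=> psiM.
have d1 (y : R) : is_derive y (1 : R) psi (derive1 psi y).
  by rewrite derive1E; apply: DeriveDef => //; have [] := psiM y.
have d2 (y : R) : is_derive y (1 : R) (derive1 psi) (derive1 (derive1 psi) y).
  by rewrite derive1E; apply: DeriveDef => //; have [] := psiM y.
(* The claim amounts to [g (z + w) <= g z]. The mean value theorem is used on [g], then on the
   derivative of [psi]. *)
pose g (x : R) := psi x - derive1 psi z * x - M / 2 * (x - z) ^+ 2.
pose dg (x : R) := derive1 psi x - derive1 psi z - M * (x - z).
have gd (y : R) : is_derive y (1 : R) g (dg y).
  apply: is_derive_eq.
  by rewrite /dg /GRing.scale/=; field.
have [t /andP[t0 t1]] := MVT_affine z w gd.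
have [s /andP[s0 s1]] := MVT_affine z (t * w) d2.
have [_ _ psi2] := psiM (z + s * (t * w)).
rewrite /g /dg => E1 E2.
suff : (derive1 psi (z + t * w) - derive1 psi z - M * (z + t * w - z)) * w <= 0.
  by rewrite -E2; lra.
rewrite E1.
(* The increment now occurs squared, so only the sign of the second derivative minus [M] matters. *)
have -> : (derive1 (derive1 psi) (z + s * (t * w)) * (t * w) -
  M * (z + t * w - z)) * w = 
  (derive1 (derive1 psi) (z + s * (t * w)) - M) * (t * w ^+ 2) by ring.
by rewrite mulr_le0_ge0 ?subr_le0// mulr_ge0 ?sqr_ge0.
Qed.

(** * Inner products and design matrices *)

Section inner_theory.
Context (R : realType) (d : nat).
Implicit Types u v w : 'cV[R]_d.

Lemma innerDl u v w : inner (u + v) w = inner u w + inner v w.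
Proof.
by rewrite /inner -big_split; apply: eq_bigr => i _; rewrite mxE mulrDl.
Qed.

Lemma innerZl c u v : inner (c *: u) v = c * inner u v.
Proof.
by rewrite /inner mulr_sumr; apply: eq_bigr => i _; rewrite mxE mulrA.
Qed.

Lemma innerC u v : inner u v = inner v u.
Proof. by apply: eq_bigr => i _; rewrite mulrC. Qed.

Lemma inner_ge0 u : 0 <= inner u u.
Proof. by apply: sumr_ge0 => i _; rewrite -expr2 sqr_ge0. Qed.

Lemma inner_gt0 u : u != 0 -> 0 < inner u u.
Proof.
move=> u0; rewrite lt_neqAle inner_ge0 andbT eq_sym; apply: contra u0.
rewrite /inner psumr_eq0 => [/allP u0|i _]; last by rewrite -expr2 sqr_ge0.
apply/eqP/colP => i; rewrite mxE.
by have := u0 i (mem_index_enum _); rewrite /= -expr2 sqrf_eq0 => /eqP.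
Qed.

Lemma innerE u v : u^T *m v = (inner u v)%:M.
Proof.
apply/matrixP => i j; rewrite !mxE !ord1 eqxx mulr1n.
by apply: eq_bigr => k _; rewrite mxE.
Qed.

Lemma sqr_norm2 u : norm2 u ^+ 2 = inner u u.
Proof. by rewrite sqr_sqrtr// inner_ge0. Qed.

End inner_theory.

Section design_matrix.
Context (R : realType) (d : nat) (c : R) (x : nat -> 'cV[R]_d) (n : nat).
Hypothesis c0 : 0 <= c.

Local Notation B := (c *: (\sum_(1 <= t < n.+1) x t *m (x t)^T) + 1%:M).

Lemma qform_design u :
  qform B u = c * (\sum_(1 <= t < n.+1) inner u (x t) ^+ 2) + inner u u.
Proof.
rewrite /qform mulmxDr mulmxDl mulmx1 innerE -scalemxAr -scalemxAl mxE.
congr (_ + _); last by rewrite mxE mulr1n.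
rewrite mxE; congr (_ * _).
rewrite mulmx_sumr mulmx_suml summxE; apply: eq_bigr => t _.
rewrite mulmxA innerE -mulmxA innerE -scalar_mxM mxE mulr1n.
by rewrite (innerC (x t)).
Qed.

Lemma qform_design_ge0 u : 0 <= qform B u.
Proof.
rewrite qform_design addr_ge0 ?inner_ge0// mulr_ge0//.
by apply: sumr_ge0 => t _; exact: sqr_ge0.
Qed.

Lemma posdef_design : posdef B.
Proof.
split.
  rewrite linearD linearZ/= trmx1 raddf_sum/=; congr (_ *: _ + _).
  by apply: eq_bigr => t _; rewrite trmx_mul trmxK.
move=> u u0; rewrite qform_design ltr_wpDl ?inner_gt0// mulr_ge0//.
by apply: sumr_ge0 => t _; exact: sqr_ge0.
Qed.

Lemma trace_design : \tr B = c * (\sum_(1 <= t < n.+1) inner (x t) (x t)) + d%:R.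
Proof.
rewrite mxtraceD mxtraceZ mxtrace1 raddf_sum/=; congr (_ * _ + _).
by apply: eq_bigr => t _; rewrite mxtrace_mulC innerE mxtrace_scalar mulr1n.
Qed.

End design_matrix.

(** * Optimality of the penalised estimator *)

Lemma qform_le_box (R : realType) (d : nat) (A : 'M[R]_d) (u : 'cV[R]_d) (e : R) :
  (forall i, `|u i ord0| <= e) ->
  qform A u <= e ^+ 2 * \sum_j \sum_k `|A k j|.
Proof.
move=> ue; rewrite /qform mxE mulr_sumr; apply: ler_sum => j _.
rewrite mxE mulr_suml mulr_sumr; apply: ler_sum => k _.
rewrite mxE (le_trans (ler_norm _))// !normrM expr2 mulrAC.
by rewrite ler_wpM2r// ler_pM.
Qed.

Lemma rat_vector_dense (R : realType) (d : nat) (a : 'cV[R]_d) (e : R) : 0 < e ->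
  exists q : 'cV[rat]_d, forall i, `|ratr (q i ord0) - a i ord0| < e.
Proof.
move=> e0.
have ex i : exists q : rat, `|ratr q - a i ord0| < e.
  have /rat_in_itvoo[q] : a i ord0 - e < a i ord0 + e by lra.
  by rewrite in_itv/= => qe; exists q; rewrite ltr_distl.
have /choice[f fP] := ex.
by exists (\col_i f i) => i; rewrite mxE.
Qed.

(** At [s = - a / (b + 1)] the expression equals [- a ^+ 2 / (b + 1) ^+ 2]. *)
Lemma linear_term_eq0 (R : realType) (a b : R) : 0 <= b ->
  (forall s, 0 <= s * a + s ^+ 2 * b) -> a = 0.
Proof.
move=> b0 /(_ (- a / (b + 1))) H; apply/eqP; rewrite -sqrf_eq0 eq_le sqr_ge0 andbT.
have b1 : 0 < b + 1 by rewrite ltr_wpDl.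
have : - (a ^+ 2) / (b + 1) ^+ 2 >= 0.
  by rewrite (le_trans H)// le_eqVlt; apply/orP; left; apply/eqP; field;
    rewrite gt_eqF.
by rewrite pmulr_lge0 ?invr_gt0 ?exprn_gt0// oppr_ge0.
Qed.

Section penalized_argmin.
Context (R : realType) (d : nat) (h psi : R -> R) (M gamma : R).
Hypotheses (M0 : 0 < M) (g0 : 0 < gamma) (psiM : smooth M psi).
Variables (x : nat -> 'cV[R]_d) (y : nat -> R) (n : nat).

Local Notation S theta :=
  (\sum_(1 <= t < n.+1) glm_loss h psi (x t) (y t) theta).
Local Notation B :=
  ((gamma ^+ 2 * M) *: (\sum_(1 <= t < n.+1) x t *m (x t)^T) + 1%:M).

Variable that : 'cV[R]_d.
Hypothesis thatP : is_argmin (fun theta => S theta + rho gamma theta) that.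

(** Smoothness gives a quadratic upper model around [that], whose linear term vanishes by
    minimality. Displacements are scaled by [gamma] so that the penalty contributes the identity
    matrix in [B]. *)
Lemma argmin_quadratic_bound u :
  S (that + gamma *: u) + rho gamma (that + gamma *: u) <=
  S that + rho gamma that + 2^-1 * qform B u.
Proof.
have gn0 : gamma != 0 by rewrite gt_eqF.
(* [D v] is the derivative of the penalised loss at [that] in the direction [gamma *: v]. *)
pose D v := gamma * (\sum_(1 <= t < n.+1)
   (derive1 psi (inner that (x t)) - y t) * inner v (x t)) + gamma^-1 * inner that v.
have ub v : S (that + gamma *: v) + rho gamma (that + gamma *: v) <=
    S that + rho gamma that + D v + 2^-1 * qform B v.
  rewrite qform_design /rho !sqr_norm2 innerDl !(innerC _ (that + _)) !innerDl.
  rewrite !innerZl (innerC v that) (innerC v (_ *: _)) innerZl.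
  have : S (that + gamma *: v) <= S that +
      \sum_(1 <= t < n.+1)
       (gamma * ((derive1 psi (inner that (x t)) - y t) * inner v (x t))
        + M / 2 * gamma ^+ 2 * inner v (x t) ^+ 2).
    rewrite -big_split/=; apply: ler_sum => t _; rewrite /glm_loss innerDl innerZl.
    have := smooth_quadratic_bound (inner that (x t)) (gamma * inner v (x t)) psiM.
    by rewrite exprMn; lra.
  rewrite [X in _ <= _ + X]big_split/= -!mulr_sumr.
  rewrite (innerC that (_ *: _)) innerZl (innerC v that).
  move=> H; rewrite /D.
  have -> : (inner that that + gamma * inner that v +
     (gamma * inner that v + gamma * (gamma * inner v v))) / (2 * gamma ^+ 2) =
     inner that that / (2 * gamma ^+ 2) + gamma^-1 * inner that v + inner v v / 2.
    by field.
  by lra.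
have DZ s v : D (s *: v) = s * D v.
  rewrite /D (innerC that) innerZl (innerC v) mulrDr; congr (_ + _); last by ring.
  rewrite mulrCA; congr (_ * _); rewrite mulr_sumr; apply: eq_bigr => t _.
  by rewrite innerZl; ring.
have BZ s v : qform B (s *: v) = s ^+ 2 * qform B v.
  by rewrite /qform [_^T]linearZ /= -scalemxAr -!scalemxAl scalerA mxE expr2.
(* Minimality against the model along the whole line [s *: u] leaves no room for a linear term. *)
suff D0 : D u = 0 by have := ub u; rewrite D0 addr0.
apply: (@linear_term_eq0 _ _ (2^-1 * qform B u)).
  by rewrite mulr_ge0// qform_design_ge0// mulr_ge0 ?sqr_ge0// ltW.
move=> s; have := le_trans (thatP _) (ub (s *: u)).
by rewrite DZ BZ -addrA lerDl [2^-1 * (_ * _)]mulrCA.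
Qed.

(** The previous bound at [u = v - gamma^-1 *: that], with the penalty at [gamma *: v] moved to the
    right. Up to sign, the last term is the exponent that [gaussian_integral] integrates. *)
Lemma argmin_gaussian_bound v :
  S (gamma *: v) <=
  S that + rho gamma that + 2^-1 * (qform B (v - gamma^-1 *: that) - inner v v).
Proof.
have gn0 : gamma != 0 by rewrite gt_eqF.
have := argmin_quadratic_bound (v - gamma^-1 *: that).
rewrite scalerBr scalerA divff// scale1r subrKC /rho !sqr_norm2.
rewrite innerZl innerC innerZl.
have -> : gamma * (gamma * inner v v) / (2 * gamma ^+ 2) = 2^-1 * inner v v by field.
by lra.
Qed.

(* No measurability of the estimator is assumed: it enters the confidence set
   only through the minimum, which this characterises by countably many
   evaluations. *)
Lemma penalized_min_lt_rat (r : R) :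
  S that + rho gamma that < r <->
  exists q : 'cV[rat]_d, S (map_mx ratr q) + rho gamma (map_mx ratr q) < r.
Proof.
split=> [mr|[q qr]]; last exact: le_lt_trans (thatP _) qr.
pose K := \sum_j \sum_k `|B k j|.
have K0 : 0 <= K by apply: sumr_ge0 => j _; apply: sumr_ge0.
pose e0 := r - (S that + rho gamma that).
have e00 : 0 < e0 by rewrite subr_gt0.
(* With [e <= 1] and [e * (K + 1) <= e0], the form at [u] is at most [e0], and half of it stays
   strictly below the gap. *)
pose e := Num.min 1 (e0 / (K + 1)).
have K1 : 0 < K + 1 by rewrite ltr_wpDl.
have ep : 0 < e by rewrite lt_min ltr01 divr_gt0.
have [q qP] := rat_vector_dense that (mulr_gt0 g0 ep).
exists q; pose u := gamma^-1 *: (map_mx ratr q - that).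
have uE : map_mx ratr q = that + gamma *: u.
  by rewrite scalerA divff ?gt_eqF// scale1r subrKC.
rewrite uE; apply: le_lt_trans (argmin_quadratic_bound u) _.
have : qform B u <= e ^+ 2 * K.
  apply: qform_le_box => i; rewrite !mxE normrM gtr0_norm ?invr_gt0//.
  by rewrite ler_pdivrMl// ltW.
have e1 : e <= 1 by rewrite ge_min lexx.
have : e * (K + 1) <= e0 by rewrite -ler_pdivlMr// ge_min lexx orbT.
have : e ^+ 2 * K <= e * K by rewrite ler_wpM2r// expr2 ler_piMl// ltW.
rewrite /e0; move: ep; set E := e ^+ 2 * K; lra.
Qed.

End penalized_argmin.

(** * Ville's inequality *)

Section ville.
Local Open Scope ereal_scope.
Context d (T : measurableType d) (R : realType) (P : probability T R).
Variables (G : nat -> set (set T)) (W : nat -> T -> \bar R).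
Hypotheses (ndG : forall n, G n `<=` G n.+1) (mG : forall n, G n `<=` measurable).
Local Notation F n := <<s G n >>.
Hypotheses (mW : forall n, measurable_fun setT (W n)) (W0 : forall n w, 0 <= W n w).
Hypothesis superW : forall n A, F n A ->
  \int[P]_(w in A) W n.+1 w <= \int[P]_(w in A) W n w.

(** Adaptedness is carried by the events [E n], on which [W n] is at least [c], rather than by level
    sets of [W n]. *)
Lemma ville_inequality (E : nat -> set T) (c : R) : (0 < c)%R ->
  (forall n, F n (E n)) -> (forall n w, E n w -> c%:E <= W n w) ->
  \int[P]_w W 0%N w <= 1 ->
  P (\bigcup_n E n) <= (c^-1)%:E.
Proof.
move=> c0 FE EW W01.
(* [U n] collects the events before time [n], so [U n.+1] and its complement lie in [F n], where
   [superW] compares [W n.+1] with [W n]. *)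
pose U n := \big[setU/set0]_(k < n) E k.
have US n : U n.+1 = U n `|` E n by rewrite /U big_ord_recr.
have FS n : F n `<=` F n.+1 by apply: sub_sigma_algebra2; exact: ndG.
have FI n A B : F n A -> F n B -> F n (A `&` B).
  exact: (@measurableI _ (g_sigma_algebraType (G n))).
have FC n A : F n A -> F n (~` A).
  exact: (@measurableC _ (g_sigma_algebraType (G n))).
have FU n : F n (~` U n.+1).
  elim: n => [|n IH]; rewrite US setCU; apply: (FI); try exact: (FC _ _ (FE _)).
    by rewrite /U big_ord0 setC0; exact: (@measurableT _ (g_sigma_algebraType (G 0%N))).
  exact: FS.
have mE n : measurable (E n).
  exact: (smallest_sub (@sigma_algebra_measurable _ T) (@mG n)).
have mU n : measurable (U n) by exact: bigsetU_measurable.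
(* The stopped process, split according to whether an [E k] has occurred. *)
have main n : c%:E * P (U n) + \int[P]_(w in ~` U n) W n w <= 1.
  elim: n => [|n IH].
    by rewrite /U big_ord0 measure0 mule0 add0e setC0.
  apply: le_trans IH.
  have dU : U n.+1 = U n `|` (E n `\` U n) by rewrite US setDE setUIr setUv setIT.
  have dC : ~` U n = (E n `\` U n) `|` ~` U n.+1.
    by rewrite US setCU setDE setIC -setIUr setUv setIT.
  rewrite [X in P X]dU measureU//; last 2 first.
    exact: measurableD.
    by rewrite setDE setICA setICr setI0.
  rewrite ge0_muleDr// -addeA leeD2l// [in leRHS]dC ge0_integral_setU//=; last 4 first.
  - exact: measurableD.
  - exact: measurableC.
  - exact: measurable_funTS.
  - by apply/disj_set2P/seteqP; split => // w [[Ew _]]; rewrite US; apply; right.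
  (* Where [E n] is the first event to occur, [c] is at most [W n]; where none has occurred up to
     [n], the supermartingale property applies. *)
  apply: leeD; last exact: superW.
  rewrite -integral_cst//; last exact: measurableD.
  apply: ge0_le_integral => //.
  - exact: measurableD.
  - by move=> w _; rewrite lee_fin ltW.
  - exact: measurable_funTS.
  - by move=> w [Ew _]; exact: EW.
have -> : \bigcup_n E n = \bigcup_n U n.
  apply/seteqP; split => [w [n _ Ew]|w [n _ Uw]]; last exact: bigsetU_bigcup Uw.
  by exists n.+1 => //; rewrite US; right.
have cvgU : P (U n) @[n --> \oo] --> P (\bigcup_n U n).
  apply: nondecreasing_cvg_mu => //; first exact: bigcup_measurable.
  by apply/nondecreasing_seqP => n; apply/subsetPset; rewrite US; exact: subsetUl.
rewrite -(cvg_lim _ cvgU)//; apply: lime_le.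
  by apply/cvg_ex; exists (P (\bigcup_n U n)).
apply: nearW => n.
rewrite -(@lee_pmul2l _ c%:E)// -EFinM divff ?gt_eqF//.
apply: le_trans (main n); rewrite leeDl//; exact: integral_ge0.
Qed.

End ville.

(** * The mixture martingale *)

Lemma derivable_measurable (R : realType) (f : R -> R) :
  (forall x, derivable f x 1) -> measurable_fun setT f.
Proof.
move=> fd; apply: continuous_measurable_fun => x.
exact/differentiable_continuous/derivable1_diffP.
Qed.

Lemma measurable_det (R : realType) (n : nat) d (T : measurableType d)
    (A : T -> 'M[R]_n) :
  (forall i j, measurable_fun setT (fun s => A s i j)) ->
  measurable_fun setT (fun s => \det (A s)).
Proof.
move=> mA; apply: measurable_sum => s; apply: measurable_funM => //.
exact: measurable_prod.
Qed.

Lemma measurable_lt_set d (T : measurableType d) (R : realType) (f g : T -> R) :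
  measurable_fun setT f -> measurable_fun setT g ->
  measurable [set s | f s < g s].
Proof.
move=> mf mg.
have -> : [set s | f s < g s] = setT `&` (g \- f) @^-1` `]0, +oo[.
  by rewrite setTI; apply/seteqP; split => s /=; rewrite in_itv/= andbT subr_gt0.
exact: measurable_funB.
Qed.

(* The logarithm of [p(y | x, theta) / p(y | x, theta0)], where [h y] cancels. *)
Definition log_ratio (R : realType) (d : nat) (psi : R -> R)
    (x : 'cV[R]_d) (y : R) (theta0 theta : 'cV[R]_d) : R :=
  (inner theta x * y - psi (inner theta x))
  - (inner theta0 x * y - psi (inner theta0 x)).

Lemma measurable_log_ratio (R : realType) (n : nat) (psi : R -> R) theta0
    d (T : measurableType d)
    (x theta : T -> 'cV[R]_n) (y : T -> R) :
  measurable_fun setT psi ->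
  (forall i, measurable_fun setT (fun s => x s i ord0)) ->
  (forall i, measurable_fun setT (fun s => theta s i ord0)) ->
  measurable_fun setT y ->
  measurable_fun setT (fun s => log_ratio psi (x s) (y s) theta0 (theta s)).
Proof.
move=> mpsi mx mth my.
have m1 (th : T -> 'cV[R]_n) : (forall i, measurable_fun setT (fun s => th s i ord0)) ->
    measurable_fun setT (fun s => inner (th s) (x s) * y s - psi (inner (th s) (x s))).
  move=> mth'; have mi := measurable_inner mth' mx.
  apply: measurable_funB; first exact: measurable_funM.
  exact: measurableT_comp.
by apply: measurable_funB; exact: m1.
Qed.

Lemma expR_log_ratio (R : realType) (d : nat) (h psi : R -> R) x y
    (theta0 theta : 'cV[R]_d) :
  expR (log_ratio psi x y theta0 theta) * glm_density h psi x theta0 y =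
  glm_density h psi x theta y.
Proof. by rewrite /glm_density mulrA -expRD /log_ratio subrK. Qed.

Lemma measurable_preimage_set_system (T : pointedType) (G : set (set T))
    d (U : measurableType d) (f : T -> U) :
  preimage_set_system setT f measurable `<=` G ->
  measurable_fun (T := g_sigma_algebraType G) setT f.
Proof.
move=> fG _ B mB; apply: sub_sigma_algebra; apply: fG.
by exists B => //; rewrite setTI.
Qed.

Section mixture.
Context (R : realType) (d : nat) (Yset : set R) (nu : {measure set R -> \bar R}).
Context (h psi : R -> R) (dO : measure_display) (Omega : measurableType dO).
Variables (P : probability Omega R).
Variables (X : nat -> Omega -> 'cV[R]_d) (Y : nat -> Omega -> R).
Variables (thetastar : 'cV[R]_d).
Hypotheses (mYset : measurable Yset) (sfnu : sigma_finite Yset nu).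
Hypothesis h_ge0 : forall y, Yset y -> 0 <= h y.
Hypothesis psi_diff : forall z : R, derivable psi z 1.
Hypothesis p_density : forall x theta : 'cV[R]_d,
  is_density Yset nu (glm_density h psi x theta).
Hypothesis mX : forall (t : nat) (i : 'I_d), (1 <= t)%N ->
  measurable_fun setT (fun w => X t w i ord0).
Hypothesis mY : forall t : nat, (1 <= t)%N -> measurable_fun setT (Y t).
Hypothesis Y_in : forall (t : nat) (w : Omega), (1 <= t)%N -> Yset (Y t w).
Hypothesis Y_cond : forall t : nat, (1 <= t)%N ->
  cond_density P (history X Y t.-1) Yset nu (Y t)
    (fun w => glm_density h psi (X t w) thetastar).

(* [history X Y n] is the sigma-algebra generated by this family. *)
Definition history_gen (n : nat) : set (set Omega) :=
  (\bigcup_(t in [set t | (1 <= t <= n.+1)%N]) \bigcup_(i in [set: 'I_d])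
     preimage_set_system setT (fun w => X t w i ord0) measurable)
  `|`
  (\bigcup_(t in [set t | (1 <= t <= n)%N])
     preimage_set_system setT (Y t) measurable).

Let OF n := g_sigma_algebraType (history_gen n).

Lemma history_gen_nd n : history_gen n `<=` history_gen n.+1.
Proof.
move=> A [[t /andP[t1 tn] AX]|[t /andP[t1 tn] AY]].
  by left; exists t => //=; rewrite t1 (leq_trans tn).
by right; exists t => //=; rewrite t1 (leq_trans tn).
Qed.

Lemma history_gen_measurable n : history_gen n `<=` measurable.
Proof.
move=> A [[t /andP[t1 _] [i _ [B mB <-]]]|[t /andP[t1 _] [B mB <-]]].
  exact: mX.
exact: mY.
Qed.

Lemma measurable_history_X n t i : (1 <= t <= n.+1)%N ->
  measurable_fun (T := OF n) setT (fun w => X t w i ord0).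
Proof.
move=> tn; apply: measurable_preimage_set_system => A AX.
by left; exists t => //; exists i.
Qed.

Lemma measurable_history_Y n t : (1 <= t <= n)%N ->
  measurable_fun (T := OF n) setT (Y t).
Proof.
move=> tn; apply: measurable_preimage_set_system => A AY.
by right; exists t.
Qed.

Let mpsi : measurable_fun setT psi. Proof. exact: derivable_measurable. Qed.

Definition log_LR (n : nat) (w : Omega) (theta : 'cV[R]_d) : R :=
  \sum_(1 <= t < n.+1) log_ratio psi (X t w) (Y t w) thetastar theta.

Lemma cum_lossB n w theta :
  cum_loss h psi X Y n w thetastar - cum_loss h psi X Y n w theta =
  log_LR n w theta.
Proof.
rewrite /cum_loss /log_LR -sumrB; apply: eq_bigr => t _.
by rewrite /glm_loss /log_ratio; ring.
Qed.

(** The source space is left free: the lemma serves both on the product with the prior space and on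
    [Omega] with a history sigma-algebra. *)
Lemma measurable_log_LR d1 (T : measurableType d1) (n : nat)
    (f : T -> Omega) (theta : T -> 'cV[R]_d) :
  (forall t i, (1 <= t <= n)%N -> measurable_fun setT (fun s => X t (f s) i ord0)) ->
  (forall t, (1 <= t <= n)%N -> measurable_fun setT (fun s => Y t (f s))) ->
  (forall i, measurable_fun setT (fun s => theta s i ord0)) ->
  measurable_fun setT (fun s => log_LR n (f s) (theta s)).
Proof.
move=> mXf mYf mth.
rewrite /log_LR; under eq_fun do rewrite big_add1 big_mkord.
apply: measurable_sum => i; apply: measurable_log_ratio => //.
- by move=> j; apply: mXf; exact: ltn_ord.
- by apply: mYf; exact: ltn_ord.
Qed.

Variables (d1 : measure_display) (T : measurableType d1) (mu : probability T R).
Variables (theta : T -> 'cV[R]_d).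
Hypothesis mtheta : forall i, measurable_fun setT (fun s => theta s i ord0).
Local Open Scope ereal_scope.

Definition mixture (n : nat) (w : Omega) : \bar R :=
  \int[mu]_s (expR (log_LR n w (theta s)))%:E.

Lemma measurable_LR n :
  measurable_fun setT (fun z : Omega * T => (expR (log_LR n z.1 (theta z.2)))%:E).
Proof.
apply/measurable_EFinP; apply: measurableT_comp => //.
apply: (@measurable_log_LR _ _ n fst (theta \o snd)) => [t i|t|i].
- by case/andP => t1 _; exact: (measurableT_comp (mX i t1) measurable_fst).
- by case/andP => t1 _; exact: (measurableT_comp (mY t1) measurable_fst).
- exact: (measurableT_comp (mtheta i) measurable_snd).
Qed.

Lemma measurable_mixture n : measurable_fun setT (mixture n).
Proof.
by apply: (measurable_fun_fubini_tonelli_F _ (measurable_LR n)).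
Qed.

Lemma mixture_ge0 n w : 0 <= mixture n w.
Proof. by apply: integral_ge0 => s _; rewrite lee_fin expR_ge0. Qed.

Lemma mixture0 w : mixture 0 w = 1.
Proof.
rewrite /mixture; under eq_integral do rewrite /log_LR big_geq// expR0.
rewrite integral_cst// mul1e. exact: probability_setT.
Qed.

(** Given the past, the new factor is integrated against the density at [thetastar]; the product is
    the density at [th], of total mass one. *)
Lemma LR_martingale n (A : set Omega) (th : 'cV[R]_d) : history X Y n A ->
  \int[P]_(w in A) (expR (log_LR n.+1 w th))%:E =
  \int[P]_(w in A) (expR (log_LR n w th))%:E.
Proof.
move=> FA.
(* The indicator of [A], the past ratio and the new factor, as a function of the history and of a
   free label. *)
pose g (z : OF n * R) : \bar R := (\1_A (z.1 : Omega) *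
  (expR (log_LR n z.1 th) * expR (log_ratio psi (X n.+1 z.1) z.2 thetastar th)))%:E.
(* [h] is known to be measurable and nonnegative on [Yset] only. *)
pose f (z : OF n * R) : R := glm_density (h \_ Yset) psi (X n.+1 z.1) thetastar z.2.
(* The covariate at time [n.+1] already belongs to the history at [n]; only the label is new. *)
have mX1 i : measurable_fun setT (fun z : OF n * R => X n.+1 z.1 i ord0).
  apply: (measurableT_comp (measurable_history_X _ _) measurable_fst).
  by rewrite leqnn.
have mA : measurable_fun setT (\1_A : OF n -> R) by exact: measurable_indic.
have mLR : measurable_fun setT (fun w : OF n => log_LR n w th).
  apply: (@measurable_log_LR _ (OF n) n id (cst th)) => [t i /andP[t1 tn]|t tn|//].
    by apply: measurable_history_X; rewrite t1 (leq_trans tn).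
  exact: measurable_history_Y.
have mg : measurable_fun setT g.
  apply/measurable_EFinP; apply: measurable_funM.
    exact: (measurableT_comp mA measurable_fst).
  apply: measurable_funM; apply: measurableT_comp => //.
    exact: (measurableT_comp mLR measurable_fst).
  exact: measurable_log_ratio.
have g0 z : 0 <= g z by rewrite lee_fin !mulr_ge0 ?expR_ge0.
have mh : measurable_fun setT (h \_ Yset).
  apply: (measurable_restrictT _ mYset).1.
  have [m0 _ _] := p_density 0 0; set i := inner (0 : 'cV[R]_d) 0.
  (* Measurability of [h] on [Yset] is recovered from that of one density by undoing its exponential
     factor. *)
  have hE : h = (fun y =>
      expR (psi i - i * y) * glm_density h psi (0 : 'cV[R]_d) 0 y)%R.
    apply: funext => y; rewrite /glm_density -/i mulrA -expRD.
    by rewrite addrA subrK subrr expR0 mul1r.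
  have me : measurable_fun setT (fun y : R => expR (psi i - i * y)%R).
    by apply: measurableT_comp => //; apply: measurable_funB => //.
  by rewrite hE; exact: (measurable_funM (measurable_funTS me) m0).
have mf : measurable_fun setT f.
  have mi : measurable_fun setT (fun z : OF n * R => inner thetastar (X n.+1 z.1)).
    exact: measurable_inner.
  apply: measurable_funM; last exact: (measurableT_comp mh measurable_snd).
  apply: measurableT_comp => //; apply: measurable_funB.
    by apply: measurable_funM => //; exact: measurable_snd.
  exact: measurableT_comp.
have f0 z : (0 <= f z)%R.
  rewrite mulr_ge0 ?expR_ge0// patchE; case: ifPn => // /set_mem; exact: h_ge0.
have fE w y : Yset y -> f (w, y) = glm_density h psi (X n.+1 w) thetastar y.
  by move=> yY; rewrite /f /glm_density patchE mem_set.
have Vf : cond_density P <<s history_gen n >> Yset nu (Y n.+1) (fun w y => f (w, y)).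
  move=> A' B FA' mB BY; rewrite (Y_cond (ltn0Sn n) FA' mB BY).
  apply: eq_integral => w _; apply: eq_integral => y /set_mem yB.
  by rewrite fE//; exact: BY.
have := integral_cond_density (@history_gen_measurable n) mYset sfnu
  (mY (ltn0Sn n)) (fun w => Y_in w (ltn0Sn n)) mf f0 Vf mg g0.
rewrite /g/= => E.
rewrite integral_mkcond [RHS]integral_mkcond.
transitivity (\int[P]_w g (w, Y n.+1 w)).
  apply: eq_integral => w _; rewrite patchE /g/= indicE /log_LR.
  rewrite [in LHS]big_nat_recr//= expRD.
  by case: ifP => _; rewrite ?mul1r ?mul0r.
rewrite /g/= E; apply: eq_integral => w _.
transitivity (\int[nu]_(y in Yset) ((\1_A w * expR (log_LR n w th))%:E *
   (glm_density h psi (X n.+1 w) th y)%:E)).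
  apply: eq_integral => y /set_mem yY; rewrite fE// -!EFinM; congr (_%:E).
  by rewrite -(expR_log_ratio h psi _ y thetastar th) !mulrA.
have [m1 p0 p1] := p_density (X n.+1 w) th.
rewrite ge0_integralZl//.
- rewrite p1 mule1 patchE indicE; case: ifP => _; by rewrite ?mul1r ?mul0r.
- exact/measurable_EFinP.
Qed.

(** Tonelli exchanges the prior with [P], which reduces the claim to [LR_martingale] at each
    parameter. *)
Lemma mixture_martingale n (A : set Omega) : history X Y n A ->
  \int[P]_(w in A) mixture n.+1 w = \int[P]_(w in A) mixture n w.
Proof.
move=> FA.
have mA : measurable A.
  exact: (smallest_sub (@sigma_algebra_measurable _ Omega) (@history_gen_measurable n)).
have swap m : \int[P]_(w in A) mixture m w =
    \int[mu]_s \int[P]_(w in A) (expR (log_LR m w (theta s)))%:E.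
  pose k (z : Omega * T) := (\1_A z.1 * expR (log_LR m z.1 (theta z.2)))%:E.
  have mk : measurable_fun setT k.
    apply/measurable_EFinP; apply: measurable_funM.
      have m1 : measurable_fun setT (\1_A : Omega -> R) by exact: measurable_indic.
      exact: (measurableT_comp m1 measurable_fst).
    apply/measurable_EFinP; exact: measurable_LR.
  have k0 z : 0 <= k z by rewrite lee_fin mulr_ge0 ?expR_ge0.
  transitivity (\int[P]_w \int[mu]_s k (w, s)).
    rewrite integral_mkcond; apply: eq_integral => w _; rewrite patchE /k/= indicE.
    case: ifP => _; last by rewrite integral0_eq// => s _; rewrite mul0r.
    by apply: eq_integral => s _; rewrite mul1r.
  rewrite (fubini_tonelli _ mk k0); apply: eq_integral => s _.
  rewrite [RHS]integral_mkcond; apply: eq_integral => w _.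
  by rewrite patchE /k/= indicE; case: ifP => _; rewrite ?mul1r ?mul0r.
by rewrite !swap; apply: eq_integral => s _; exact: LR_martingale.
Qed.

End mixture.

(** * Coverage of the confidence sets and the explicit radius *)

Theorem theorem4p1 (R : realType) (d : nat) (hd : (1 <= d)%N)
    (Yset : set R) (mYset : measurable Yset)
    (nu : {measure set R -> \bar R}) (sfnu : sigma_finite Yset nu)
    (h : R -> R) (h_ge0 : forall y, Yset y -> 0 <= h y)
    (psi : R -> R) (psi_cvx : convex_function [set: R^o] psi)
    (psi_diff : forall z : R, derivable psi z 1)
    (p_density : forall x theta : 'cV[R]_d,
      is_density Yset nu (glm_density h psi x theta))
    (dO : measure_display) (Omega : measurableType dO) (P : probability Omega R)
    (X : nat -> Omega -> 'cV[R]_d) (Y : nat -> Omega -> R)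
    (mX : forall (t : nat) (i : 'I_d), (1 <= t)%N ->
      measurable_fun setT (fun w => X t w i ord0))
    (mY : forall t : nat, (1 <= t)%N -> measurable_fun setT (Y t))
    (Y_in : forall (t : nat) (w : Omega), (1 <= t)%N -> Yset (Y t w))
    (thetastar : 'cV[R]_d)
    (Y_cond : forall t : nat, (1 <= t)%N ->
      cond_density P (history X Y t.-1) Yset nu (Y t)
        (fun w => glm_density h psi (X t w) thetastar))
    (M : R) (M_gt0 : 0 < M) (psi_smooth : smooth M psi)
    (gamma : R) (gamma_gt0 : 0 < gamma)
    (thetahat : nat -> Omega -> 'cV[R]_d)
    (thetahatP : forall (n : nat) (w : Omega), (1 <= n)%N ->
      is_argmin (fun theta => cum_loss h psi X Y n w theta + rho gamma theta)
        (thetahat n w))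
    (delta : R) (delta01 : 0 < delta < 1) :
  let E : set Omega :=
    [set w | exists n : nat, (1 <= n)%N /\
       ~ Theta h psi gamma M delta X Y thetahat n w thetastar] in
  (measurable E /\ (P E <= delta%:E)%E) /\
  (forall L : R,
     (forall (t : nat) (w : Omega), (1 <= t)%N -> norm2 (X t w) <= L) ->
     forall (n : nat) (w : Omega), (1 <= n)%N ->
       beta gamma M delta X thetahat n w <=
         norm2 (thetahat n w) ^+ 2 / (2 * gamma ^+ 2)
         + d%:R / 2 * ln (1 + gamma ^+ 2 * M * L ^+ 2 * n%:R / d%:R)
         + ln (delta^-1)).
Proof.
have gM : 0 <= gamma ^+ 2 * M by rewrite mulr_ge0 ?sqr_ge0// ltW.
have [delta0 _] := andP delta01.
pose B n w := (gamma ^+ 2 * M) *: Lambda X n w + 1%:M.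
have Bpos n w : posdef (B n w) by exact: posdef_design.
have detB0 n w : 0 < \det (B n w) by exact: posdef_det_gt0.
move=> E; split; last first.
  move=> L XL n w n1; rewrite /beta lerD2r lerD2l.
  have d0 : 0 < d%:R :> R by rewrite ltr0n.
  have L0 : 0 <= L by apply: le_trans (XL 1%N w isT); exact: sqrtr_ge0.
  (* The identity contributes [d] to the trace, and each covariate at most [L ^+ 2] times the
     scaling. *)
  have tr : \tr (B n w) / d%:R <= 1 + gamma ^+ 2 * M * L ^+ 2 * n%:R / d%:R.
    rewrite trace_design mulrDl divff ?gt_eqF// addrC lerD2l ler_pM2r ?invr_gt0//.
    rewrite -[leRHS]mulrA ler_wpM2l//.
    rewrite big_add1 big_mkord /=.
    apply: le_trans (_ : \sum_(i < n) L ^+ 2 <= _); last first.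
      by rewrite sumr_const card_ord mulr_natr.
    apply: ler_sum => i _; rewrite -sqr_norm2 ler_sqr ?nnegrE ?sqrtr_ge0//.
    exact: XL.
  have tr0 : 0 < \tr (B n w) / d%:R by rewrite divr_gt0// posdef_trace_gt0.
  rewrite -/(B n w); set Z := 1 + _ in tr *.
  have Z0 : 0 < Z := lt_le_trans tr0 tr.
  have -> : d%:R / 2 * ln Z = 2^-1 * ln (Z ^+ d).
    by rewrite lnXn// -[ln Z *+ d]mulr_natl; ring.
  rewrite ler_wpM2l// ler_ln ?posrE ?exprn_gt0//.
  apply: le_trans (posdef_det_le_trace hd (Bpos n w)) _.
  by rewrite lerXn2r// nnegrE ltW.
(* [C] is the part of [beta] free of the estimator, which then enters the failure event only through
   the minimum [m]. *)
pose C n w := 2^-1 * ln (\det (B n w)) + ln delta^-1.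
pose m n w := cum_loss h psi X Y n w (thetahat n w) + rho gamma (thetahat n w).
have notTheta n w : ~ Theta h psi gamma M delta X Y thetahat n w thetastar <->
    m n w < cum_loss h psi X Y n w thetastar - C n w.
  rewrite /Theta /= sumrB -/(cum_loss h psi X Y n w _).
  rewrite -/(cum_loss _ _ _ _ _ _ (thetahat n w)).
  rewrite /beta -/(rho gamma _) -/(B n w) /m /C.
  split=> [/negP|H]; first by rewrite -ltNge; lra.
  by apply/negP; rewrite -ltNge; lra.
(* The guard empties the event at time [0], so the union may run over all [n]. *)
pose E' n := [set w | (1 <= n)%N /\
  ~ Theta h psi gamma M delta X Y thetahat n w thetastar].
have EE : E = \bigcup_n E' n.
  by apply/seteqP; split=> [w [n [n1 nT]]|w [n _ [n1 nT]]]; exists n.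
have FE n : history X Y n (E' n).
  case: n => [|n].
    rewrite (_ : E' 0%N = set0); last by apply/seteqP; split => // w [].
    exact: (@measurable0 _ (g_sigma_algebraType (history_gen X Y 0))).
  pose OF := g_sigma_algebraType (history_gen X Y n.+1).
  (* By [penalized_min_lt_rat], failure is witnessed by a rational parameter: a countable union of
     events of the history. *)
  have -> : E' n.+1 = \bigcup_(q in [set: 'cV[rat]_d]) [set w |
      rho gamma (map_mx ratr q) + C n.+1 w <
      log_LR psi X Y thetastar n.+1 w (map_mx ratr q)].
    apply/seteqP; split=> w /=.
      move=> [_ /notTheta].
      move=> /(penalized_min_lt_rat M_gt0 gamma_gt0 psi_smooth
        (thetahatP n.+1 w isT) _).1.
      move=> [q qE]; exists q => //=; rewrite -(cum_lossB h).
      by move: qE; rewrite -/(cum_loss _ _ _ _ _ _ _); lra.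
    move=> [q _ /= qE]; split=> //; apply/notTheta.
    apply/(penalized_min_lt_rat M_gt0 gamma_gt0 psi_smooth (thetahatP n.+1 w isT) _).
    exists q; move: qE; rewrite -(cum_lossB h).
    by rewrite -/(cum_loss _ _ _ _ _ _ _); lra.
  apply: (@countable_bigcupT_measurable _ OF); first exact: countableP.
  move=> q; apply: (@measurable_lt_set _ OF).
    apply: measurable_funD => //; apply: measurable_funD => //.
    apply: measurable_funM => //; apply: (measurableT_comp (@measurable_ln R)).
    apply: (@measurable_det _ _ _ OF) => i j.
    have -> : (fun w => B n.+1 w i j) = fun w => gamma ^+ 2 * M *
        (\sum_(t < n.+1) X t.+1 w i ord0 * X t.+1 w j ord0) + (i == j)%:R.
      apply/funext => w; rewrite !mxE summxE big_add1 big_mkord.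
      congr (_ * _ + _); apply: eq_bigr => t _.
      by rewrite mxE big_ord1 mxE.
    apply: measurable_funD => //; apply: measurable_funM => //.
    apply: measurable_sum => t; apply: measurable_funM;
      apply: measurable_history_X; exact: leqW.
  apply: (@measurable_log_LR _ _ _ _ _ _ _ _ psi_diff _ OF n.+1 id (cst _)) => //.
    by move=> t i /andP[t1 tn]; apply: measurable_history_X; rewrite t1 leqW.
  by move=> t tn; apply: measurable_history_Y.
have mE n : measurable (E' n).
  apply: (smallest_sub (@sigma_algebra_measurable _ Omega)
    (@history_gen_measurable _ _ _ _ _ _ mX mY n)).
  exact: FE.
rewrite EE; split; first exact: bigcup_measurable.
have [d1 [T [mu [v [mv gaussE]]]]] := gaussian_integral R d.
(* The prior: a centred Gaussian with standard deviation [gamma] in each coordinate. *)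
pose theta s := gamma *: v s.
have mtheta i : measurable_fun setT (fun s => theta s i ord0).
  by under eq_fun do rewrite mxE; exact: measurable_funM.
have mG := history_gen_measurable mX mY.
have mW n : measurable_fun setT (mixture psi X Y thetastar mu theta n).
  exact: measurable_mixture.
have W0 n w : (0 <= mixture psi X Y thetastar mu theta n w)%E by exact: mixture_ge0.
have superW n A : history X Y n A ->
    (\int[P]_(w in A) mixture psi X Y thetastar mu theta n.+1 w <=
     \int[P]_(w in A) mixture psi X Y thetastar mu theta n w)%E.
  move=> FA.
  by rewrite (mixture_martingale mYset sfnu h_ge0 psi_diff p_density mX mY
    Y_in Y_cond mu mtheta FA).
have EW n w : E' n w -> ((delta^-1)%:E <= mixture psi X Y thetastar mu theta n w)%E.
  move=> [n1 /notTheta Ew].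
  have mgauss : measurable_fun setT (fun s => (expR (2^-1 * (inner (v s) (v s) -
         qform (B n w) (v s - gamma^-1 *: thetahat n w))))%:E).
    apply/measurable_EFinP; apply: measurableT_comp => //.
    apply: measurable_funM => //; apply: measurable_funB.
      exact: measurable_inner.
    exact: measurable_qform.
  (* [argmin_gaussian_bound] under the integral; the factor free of [s] is the exponential of the
     loss gap. *)
  have lb : (\int[mu]_s ((expR (cum_loss h psi X Y n w thetastar - m n w))%:E *
      (expR (2^-1 * (inner (v s) (v s) -
         qform (B n w) (v s - gamma^-1 *: thetahat n w))))%:E) <=
      mixture psi X Y thetastar mu theta n w)%E.
    apply: ge0_le_integral => //.
    + exact: emeasurable_funM.
    + exact: (measurable_fun_pair2 w (measurable_LR thetastar psi_diff mX mY mtheta n)).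
    + move=> s _; rewrite -EFinM lee_fin -expRD ler_expR -(cum_lossB h).
      have : cum_loss h psi X Y n w (theta s) <= m n w + 2^-1 *
          (qform (B n w) (v s - gamma^-1 *: thetahat n w) - inner (v s) (v s)).
        exact: (argmin_gaussian_bound M_gt0 gamma_gt0 psi_smooth (thetahatP n w n1)).
      by lra.
  apply: le_trans lb.
  rewrite ge0_integralZl//.
  (* The Gaussian integral is the inverse root of the determinant, which the term
     [2^-1 * ln (\det (B n w))] of [C] compensates, leaving [delta^-1]. *)
  rewrite gaussE// -EFinM lee_fin ler_pdivlMr ?sqrtr_gt0//.
  have <- : expR (2^-1 * ln (\det (B n w))) = Num.sqrt (\det (B n w)).
    apply/(@pexpIrn _ 2) => //; rewrite ?nnegrE ?expR_ge0 ?sqrtr_ge0//.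
    rewrite sqr_sqrtr; last exact: ltW.
    by rewrite -expRM_natl mulrA divff// mul1r lnK ?posrE.
  rewrite -[delta^-1]lnK ?posrE ?invr_gt0// -expRD ler_expR.
  by move: Ew; rewrite /C; lra.
have W01 : (\int[P]_w mixture psi X Y thetastar mu theta 0 w <= 1)%E.
  under eq_integral do rewrite mixture0.
  by rewrite integral_cst// mul1e probability_le1.
have d0 : 0 < delta^-1 by rewrite invr_gt0.
have := ville_inequality (@history_gen_nd _ _ _ _ X Y) mG mW W0 superW d0 FE EW W01.
by rewrite invrK.
Qed.
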